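(* Let $n$ be a positive integer and let $P\subset\mathbb{Z}^n$ be a polymatroid. Then, for any permutation $w\in S_n$, $$\mathscr{T}_P(x,y)=\mathscr{T}_{w(P)}(x,y),$$ where $w(P)=\{\,(a_{w(1)},\ldots,a_{w(n)})\mid (a_1,\ldots,a_n)\in P\,\}$. In other words, the polymatroid Tutte polynomial does not depend on the choice of ordering of the coordinates.
   Context: Notation: $[n]=\{1,\dots,n\}$; $\mathbf e_1,\dots,\mathbf e_n$ is the canonical basis of $\mathbb{R}^n$; $S_n$ is the set of permutations of $[n]$. A polymatroid in $\mathbb{Z}^n$ is a finite nonempty set $P\subset\mathbb{Z}^n$ satisfying the Exchange Axiom: for any $\mathbf a,\mathbf b\in P$ and any $i\in[n]$ with $a_i>b_i$, there exists $j\in[n]$ such that $a_j<b_j$ and both $\mathbf a-\mathbf e_i+\mathbf e_j$ and $\mathbf b+\mathbf e_i-\mathbf e_j$ belong to $P$. (If $P$ is a polymatroid, so is $w(P)$.) For $\mathbf a\in P$, an index $i\in[n]$ is internally active if there is no $j<i$ with $\mathbf a-\mathbf e_i+\mathbf e_j\in P$, and externally active if there is no $j<i$ with $\mathbf a+\mathbf e_i-\mathbf e_j\in P$. Let $\mathrm{Int}(\mathbf a),\mathrm{Ext}(\mathbf a)\subseteq[n]$ be the sets of internally, respectively externally, active indices. The polymatroid Tutte polynomial is $$\mathscr{T}_P(x,y)=\sum_{\mathbf a\in P}x^{|\mathrm{Int}(\mathbf a)\setminus\mathrm{Ext}(\mathbf a)|}\,y^{|\mathrm{Ext}(\mathbf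 a)\setminus\mathrm{Int}(\mathbf a)|}\,(x+y-1)^{|\mathrm{Int}(\mathbf a)\cap\mathrm{Ext}(\mathbf a)|}.$$ *)

(* Defs.v *)
From mathcomp Require Import all_boot all_order all_fingroup all_algebra.
From mathcomp Require Import finmap mpoly.

Set Implicit Arguments.
Unset Strict Implicit.
Unset Printing Implicit Defensive.

Import GRing.Theory.

Local Open Scope ring_scope.

(* Coordinates are indexed by 'I_n, i.e. by 0, ..., n-1 with its natural
   order, instead of 1, ..., n. *)

Definition basis_vec (n : nat) (i : 'I_n) : 'rV[int]_n := delta_mx 0 i.

Definition exchange_axiom (n : nat) (P : {fset 'rV[int]_n}) : Prop :=
  forall a b : 'rV[int]_n, a \in P -> b \in P ->
  forall i : 'I_n, b 0 i < a 0 i ->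
  exists j : 'I_n,
    [/\ a 0 j < b 0 j,
        a - basis_vec i + basis_vec j \in P &
        b + basis_vec i - basis_vec j \in P].

Definition polymatroid (n : nat) (P : {fset 'rV[int]_n}) : Prop :=
  P != fset0%fset /\ exchange_axiom P.

Definition int_active (n : nat) (P : {fset 'rV[int]_n}) (a : 'rV[int]_n) :
    {set 'I_n} :=
  [set i : 'I_n | ~~ [exists j : 'I_n,
     (j < i)%N && (a - basis_vec i + basis_vec j \in P)]].

Definition ext_active (n : nat) (P : {fset 'rV[int]_n}) (a : 'rV[int]_n) :
    {set 'I_n} :=
  [set i : 'I_n | ~~ [exists j : 'I_n,
     (j < i)%N && (a + basis_vec i - basis_vec j \in P)]].

Definition varx : {mpoly int[2]} := 'X_(0 : 'I_2).
Definition vary : {mpoly int[2]} := 'X_(1 : 'I_2).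

Definition tutte (n : nat) (P : {fset 'rV[int]_n}) : {mpoly int[2]} :=
  \sum_(a <- P)
    varx ^+ #|int_active P a :\: ext_active P a|%SET *
    vary ^+ #|ext_active P a :\: int_active P a|%SET *
    (varx + vary - 1) ^+ #|int_active P a :&: ext_active P a|%SET.

(* By definition of col_perm, (col_perm w a) 0 i = a 0 (w i). *)
Definition perm_image (n : nat) (w : 'S_n) (P : {fset 'rV[int]_n}) :
    {fset 'rV[int]_n} :=
  [fset col_perm w a | a in P]%fset.

(* Main.v *)
Require Import Defs.
From mathcomp Require Import all_boot all_order all_fingroup all_algebra.
From mathcomp Require Import finmap mpoly.
From mathcomp Require Import zify ring.

Set Implicit Arguments.
Unset Strict Implicit.
Unset Printing Implicit Defensive.

Import Order.TTheory GRing.Theory Num.Theory.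

Local Open Scope ring_scope.

(** Reordering the coordinates of [P] amounts to keeping [P] and comparing
    indices through an injective rank function [r], so the claim is that
    [ranked_tutte P r] does not depend on [r].

    The reason is a generating function over all integer points.  Substitute
    [x = 1/(1-u)] and [y = 1/(1-v)].  Then [x], [y], [x + y - 1] and [1] are the
    sums of [u^((-t)^+) v^(t^+)] over, respectively, [t <= 0], [t >= 0], all
    integers [t], and [t = 0].  Hence the term of a point [a] of [P] is the sum
    of [u^(excess c a) v^(deficit c a)] over the integer points [c] lying in a
    box-shaped cone with apex [a]: the [c] with [c i < a i] only at internally
    active [i] and [c i > a i] only at externally active [i].  Such a pair is
    called [compatible].

    The cones partition the lattice.  Compatibility says exactly that no single
    exchange step in [P] decreases the separable convex function
    [cost K L c], whose slopes [K + r i] above [c i] and [L + r i] below it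
    break ties according to [r].  By the exchange axiom such a local minimum is
    the unique global one ([compatible_exists], [compatible_unique]).  As
    compatibility does not mention the positive numbers [K] and [L], letting one
    of them dominate shows that the compatible [a] minimises both the excess and
    the deficit over [P] ([compatible_min_excess_deficit]).  These minima do
    not involve [r], so neither does the generating function.

    Infinite sums are avoided by working in a ring where [u] and [v] are
    nilpotent.  In [Z/2^N], every odd [x] is invertible and [u = 1 - 1/x] is
    even, hence nilpotent; so the polynomials of two rankings agree modulo [2^N]
    at all pairs of odd numbers ([ranked_tutte_nilpotent]).  With [N] large they agree
    there as integers ([ranked_tutte_odd]), and an integer polynomial in two
    variables vanishing at all pairs of odd numbers is zero
    ([mpoly_odd_zeros]). *)

(** * Activities relative to a ranking of the indices *)

Section RankedActivity.

Variables (n : nat) (P : {fset 'rV[int]_n}) (r : 'I_n -> nat).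

Definition ranked_int_active (a : 'rV[int]_n) : {set 'I_n} :=
  [set i | ~~ [exists j,
     (r j < r i)%N && (a - basis_vec i + basis_vec j \in P)]].

Definition ranked_ext_active (a : 'rV[int]_n) : {set 'I_n} :=
  [set i | ~~ [exists j,
     (r j < r i)%N && (a + basis_vec i - basis_vec j \in P)]].

Definition ranked_tutte (R : pzRingType) (x y : R) : R :=
  \sum_(a <- P)
    x ^+ #|ranked_int_active a :\: ranked_ext_active a|%SET *
    y ^+ #|ranked_ext_active a :\: ranked_int_active a|%SET *
    (x + y - 1) ^+ #|ranked_int_active a :&: ranked_ext_active a|%SET.

(** For fixed [a], these [c] form the cone with apex [a] whose generating
    function is the term of [a] in the Tutte polynomial. *)
Definition compatible (c : 'I_n -> int) (a : 'rV[int]_n) : bool :=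
  [forall i, ((c i < a 0 i) ==> (i \in ranked_int_active a)) &&
             ((a 0 i < c i) ==> (i \in ranked_ext_active a))].

Lemma compatible_int c a i j : compatible c a -> c i < a 0 i ->
  a - basis_vec i + basis_vec j \in P -> (r i <= r j)%N.
Proof.
move=> /forallP/(_ i)/andP[+ _] lt_ca aP; rewrite lt_ca inE /= negb_exists.
by move/forallP/(_ j); rewrite aP andbT -leqNgt.
Qed.

Lemma compatible_ext c a i j : compatible c a -> a 0 j < c j ->
  a - basis_vec i + basis_vec j \in P -> (r j <= r i)%N.
Proof.
move=> /forallP/(_ j)/andP[_ +] lt_ac aP; rewrite lt_ac inE /= negb_exists.
by move/forallP/(_ i); rewrite addrAC aP andbT -leqNgt.
Qed.

(** * Compatible points as minimisers of a convex cost *)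

Definition hinge (K L z : int) : int := K * Num.max z 0 + L * Num.max (- z) 0.

Lemma hinge_pred K L z :
  hinge K L (z - 1) = hinge K L z + (if 0 < z then - K else L).
Proof.
rewrite /hinge; case: ifPn => z0.
  have -> : Num.max (z - 1) 0 = Num.max z 0 - 1 by lia.
  have -> : Num.max (- (z - 1)) 0 = Num.max (- z) 0 by lia.
  by ring.
have -> : Num.max (z - 1) 0 = Num.max z 0 by lia.
have -> : Num.max (- (z - 1)) 0 = Num.max (- z) 0 + 1 by lia.
by ring.
Qed.

Lemma hinge_succ K L z :
  hinge K L (z + 1) = hinge K L z + (if 0 <= z then K else - L).
Proof.
have := hinge_pred K L (z + 1); rewrite addrK => ->.
by rewrite ltzD1; case: ifP => _; ring.
Qed.

(** Convexity: moving two arguments towards each other by one unit does not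
    increase the sum of the values. *)
Lemma hinge_exchange K L z t : 0 <= K -> 0 <= L -> z < t ->
  hinge K L (z + 1) + hinge K L (t - 1) <= hinge K L z + hinge K L t.
Proof.
move=> K0 L0 zt; rewrite hinge_succ hinge_pred.
by case: ifPn => ?; case: ifPn => ?; lia.
Qed.

(** Adding the rank to both slopes makes a step from [i] to [j] that leaves the
    total distance to [c] unchanged profitable or not according to whether
    [r j] is smaller than [r i]. *)
Definition cost (K L : int) (c : 'I_n -> int) (a : 'rV[int]_n) : int :=
  \sum_i hinge (K + (r i)%:Z) (L + (r i)%:Z) (a 0 i - c i).

Lemma moveE (a : 'rV[int]_n) (i j k : 'I_n) :
  (a - basis_vec i + basis_vec j) 0 k = a 0 k - (k == i)%:R + (k == j)%:R.
Proof. by rewrite !mxE !eqxx. Qed.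

Lemma cost_move K L c a (i j : 'I_n) : i != j ->
  cost K L c (a - basis_vec i + basis_vec j) = cost K L c a
    + (if c i < a 0 i then - (K + (r i)%:Z) else L + (r i)%:Z)
    + (if c j <= a 0 j then K + (r j)%:Z else - (L + (r j)%:Z)).
Proof.
move=> ij; rewrite /cost (bigD1 i) //= (bigD1 j) 1?eq_sym //=.
rewrite [in RHS](bigD1 i) //= [in RHS](bigD1 j) 1?eq_sym //=.
rewrite !moveE !eqxx (negPf ij) eq_sym (negPf ij) !mulr0n mulr1n subr0 addr0.
rewrite (addrAC _ _ (- c i)) (addrAC _ _ (- c j)) hinge_pred hinge_succ.
rewrite subr_gt0 subr_ge0.
under eq_bigr => k /andP[ki kj] do
  rewrite moveE (negPf ki) (negPf kj) !mulr0n subr0 addr0.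
by case: ifP => _; case: ifP => _; ring.
Qed.

Hypothesis r_inj : injective r.

(** A step lowers the cost at [i] only if [c i < a 0 i], and at [j] only if
    [a 0 j < c j].  In the first case [i] is internally active, which forces
    [r i < r j]; in the second [j] is externally active, which forces
    [r j < r i].  So at most one end gains, and it is the end of smaller rank,
    whose gain is smaller than the loss at the other end. *)
Lemma compatible_cost_move K L c a (i j : 'I_n) : 0 < K -> 0 < L -> i != j ->
    compatible c a -> a - basis_vec i + basis_vec j \in P ->
  cost K L c a < cost K L c (a - basis_vec i + basis_vec j).
Proof.
move=> K0 L0 ij comp aP; rewrite cost_move //.
have rij : r i != r j by apply: contra ij => /eqP/r_inj->.
have int_le : c i < a 0 i -> (r i <= r j)%N.
  by move=> ci; apply: (compatible_int comp ci aP).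
have ext_le : a 0 j < c j -> (r j <= r i)%N.
  by move=> cj; apply: (compatible_ext comp cj aP).
case: ifP => [/int_le|_]; case: (leP (c j)) => [_|/ext_le ?]; lia.
Qed.

(** If [i] were an inactive index where activity is required, the step that
    witnesses this would move [a 0 i] towards [c i], gaining more than could be
    lost at the index [j] of smaller rank. *)
Lemma min_cost_compatible K L c a : 0 < K -> 0 < L ->
  (forall b, b \in P -> cost K L c a <= cost K L c b) -> compatible c a.
Proof.
move=> K0 L0 amin; apply/forallP => i; apply/andP; split; apply/implyP => lti;
  rewrite inE; apply/negP => /existsP[j /andP[rji]].
- have ij : i != j by apply: contraL rji => /eqP->; rewrite ltnn.
  move=> /amin; rewrite cost_move // lti.
  by case: ifPn => cj; lia.
- have ij : j != i by apply: contraL rji => /eqP->; rewrite ltnn.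
  rewrite addrAC => /amin; rewrite cost_move // [c i <= _]leNgt lti /=.
  by case: ifPn => cj; lia.
Qed.

Hypothesis polyP : polymatroid P.

Lemma min_cost_exists K L c :
  exists2 a, a \in P & forall b, b \in P -> cost K L c a <= cost K L c b.
Proof.
have [/fset0Pn[a0 a0P] _] := polyP.
case: (@arg_minP _ _ P [` a0P]%fset predT (fun a => cost K L c (val a))) => //.
move=> a _ amin; exists (val a); first exact: valP.
by move=> b bP; apply: (amin [` bP]%fset).
Qed.

(** Apply the exchange axiom to two compatible points: both steps would
    strictly increase the cost by [compatible_cost_move], whereas by convexity
    they do not increase the sum of the two costs. *)
Lemma compatible_unique c a b : a \in P -> b \in P ->
  compatible c a -> compatible c b -> a = b.
Proof.
move=> aP bP ca cb; apply/eqP/negPn/negP => neq_ab.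
wlog [i ba_i] : a b aP bP ca cb neq_ab / exists i, b 0 i < a 0 i.
  move=> wl; have [i ab_i] : exists i, a 0 i != b 0 i.
    apply/existsP; apply: contraR neq_ab; rewrite negb_exists => /forallP ab.
    by apply/eqP/rowP => i; apply/eqP/negPn.
  move: ab_i; rewrite neq_lt => /orP[lt_i|lt_i].
    by apply: (wl b a) => //; [rewrite eq_sym | exists i].
  by apply: (wl a b) => //; exists i.
have [_ /(_ a b aP bP i ba_i)[j [ab_j aP' bP']]] := polyP.
have ij : i != j by apply: contraTneq ba_i => ->; rewrite -leNgt ltW.
have := compatible_cost_move (ltr01 : 0 < 1 :> int) ltr01 ij ca aP'.
rewrite addrAC in bP'; rewrite eq_sym in ij.
have := compatible_cost_move (ltr01 : 0 < 1 :> int) ltr01 ij cb bP'.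
suff: cost 1 1 c (a - basis_vec i + basis_vec j)
      + cost 1 1 c (b - basis_vec j + basis_vec i)
      <= cost 1 1 c a + cost 1 1 c b.
  by move=> le_cost ltb lta; have := ltrD lta ltb; rewrite ltNge le_cost.
rewrite /cost -!big_split /=; apply: ler_sum => k _; rewrite !moveE.
have [->|ki] := eqVneq k i.
  rewrite [i == j]eq_sym (negPf ij) !mulr0n mulr1n !addr0.
  rewrite (addrAC _ (- 1)) (addrAC _ 1) [leLHS]addrC [leRHS]addrC.
  by apply: hinge_exchange; rewrite ?ltrD2r.
have [->|kj] := eqVneq k j.
  rewrite !mulr0n mulr1n !subr0 (addrAC _ (- 1)) (addrAC _ 1).
  by apply: hinge_exchange; rewrite ?ltrD2r.
by rewrite !mulr0n !addr0.
Qed.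

Lemma compatible_exists c : exists2 a, a \in P & compatible c a.
Proof.
have [a aP amin] := min_cost_exists 1 1 c; exists a => //.
exact: min_cost_compatible amin.
Qed.

Lemma compatible_min_cost K L c a b : 0 < K -> 0 < L ->
  a \in P -> b \in P -> compatible c a -> cost K L c a <= cost K L c b.
Proof.
move=> K0 L0 aP bP ca; have [a' a'P amin] := min_cost_exists K L c.
have ca' := min_cost_compatible K0 L0 amin.
by rewrite (compatible_unique aP a'P ca ca') amin.
Qed.

(** * Excess and deficit of the compatible point *)

Definition excess (c : 'I_n -> int) (a : 'rV[int]_n) : int :=
  \sum_i Num.max (a 0 i - c i) 0.
Definition deficit (c : 'I_n -> int) (a : 'rV[int]_n) : int :=
  \sum_i Num.max (c i - a 0 i) 0.

Lemma cost_shift K L M N c a :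
  cost (K + M) (L + N) c a = cost K L c a + M * excess c a + N * deficit c a.
Proof.
rewrite /cost /excess /deficit !mulr_sumr -!big_split /=; apply: eq_bigr => i _.
by rewrite /hinge opprB; ring.
Qed.

Lemma cost_ge0 K L c a : 0 <= K -> 0 <= L -> 0 <= cost K L c a.
Proof.
move=> K0 L0; apply: sumr_ge0 => i _.
by apply: addr_ge0; apply: mulr_ge0; lia.
Qed.

(** The compatible point minimises [cost K L c] for all positive [K] and [L] at
    once; a slope exceeding every other contribution to the comparison isolates
    the excess or the deficit. *)
Lemma compatible_min_excess_deficit c a b :
    a \in P -> b \in P -> compatible c a ->
  excess c a <= excess c b /\ deficit c a <= deficit c b.
Proof.
move=> aP bP ca; pose M : int := cost 1 1 c b + 1.
have a_ge0 := @cost_ge0 1 1 c a isT isT.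
have M_gt0 : 0 < M by rewrite ltzD1 cost_ge0.
have le_cost (K L : int) : 0 <= K -> 0 <= L ->
    cost 1 1 c a + K * excess c a + L * deficit c a <=
    cost 1 1 c b + K * excess c b + L * deficit c b.
  by move=> K0 L0; rewrite -!cost_shift compatible_min_cost //; lia.
have M_big (s t : int) : M * s < M + M * t -> s <= t.
  by rewrite -{2}[M]mulr1 -mulrDr ltr_pM2l // addrC ltzD1.
have cost_b : cost 1 1 c b < M by rewrite /M ltzD1.
split; apply: M_big.
  have le_ab := le_cost M 0 (ltW M_gt0) isT; rewrite !mul0r !addr0 in le_ab.
  rewrite -(ltrD2r (M * excess c b)) in cost_b.
  by apply: le_lt_trans cost_b; apply: le_trans le_ab; rewrite lerDr.
have le_ab := le_cost 0 M isT (ltW M_gt0); rewrite !mul0r !addr0 in le_ab.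
rewrite -(ltrD2r (M * deficit c b)) in cost_b.
by apply: le_lt_trans cost_b; apply: le_trans le_ab; rewrite lerDr.
Qed.

End RankedActivity.

(** * The Tutte polynomial as a generating function over lattice points *)

Section LatticePointSum.

Variables (R : comPzRingType) (N : nat) (x y u v : R).
Hypotheses (uN : u ^+ N = 0) (vN : v ^+ N = 0).
Hypotheses (xu : x * (1 - u) = 1) (yv : y * (1 - v) = 1).

Lemma geometric_sum (z w : R) l : w ^+ N = 0 -> z * (1 - w) = 1 ->
  (N <= l)%N -> \sum_(k < l) w ^+ k = z.
Proof.
move=> wN zw Nl; rewrite -[LHS]mul1r -zw -mulrA -(opprB w) mulNr -subrX1.
by rewrite -(subnK Nl) exprD wN mulr0 sub0r opprK mulr1.
Qed.

Lemma sum_below s : (N <= s.+1)%N -> \sum_(k < s) u ^+ (s - k) = x - 1.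
Proof.
move=> Ns; rewrite -(geometric_sum uN xu Ns) big_ord_recl expr0 addrC addKr.
rewrite (reindex_inj rev_ord_inj) /=; apply: eq_bigr => k _.
by congr (u ^+ _); rewrite /bump; have := ltn_ord k; lia.
Qed.

Lemma sum_above s m : (s + N <= m)%N -> (s < m)%N ->
  \sum_(s.+1 <= k < m) v ^+ (k - s) = y - 1.
Proof.
move=> Nm sm; have Nms : (N <= (m - s.+1).+1)%N by lia.
rewrite -(geometric_sum vN yv Nms) big_ord_recl expr0 addrC addKr.
rewrite -{1}[s.+1]add0n big_addn big_mkord; apply: eq_bigr => k _.
by rewrite lift0 -addSnnS addnK.
Qed.

(** The contribution of one coordinate: up to a common shift, [s] is the
    coordinate of [a] and [k] runs over that of [c], while [I], [E] say whether the index is internally and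
    externally active.  The margin of [N] on both sides of [s] suffices to
    complete the geometric series, since [u ^+ N = v ^+ N = 0]. *)
Lemma sum_coordinate (I E : bool) s m :
    (N <= s.+1)%N -> (s + N <= m)%N -> (s < m)%N ->
  \sum_(k < m) (if ((k < s)%N ==> I) && ((s < k)%N ==> E)
                then u ^+ (s - k) * v ^+ (k - s) else 0) =
  if I then if E then x + y - 1 else x else if E then y else 1.
Proof.
move=> Ns Nm sm.
pose F k := if ((k < s)%N ==> I) && ((s < k)%N ==> E)
            then u ^+ (s - k) * v ^+ (k - s) else 0.
rewrite -(big_mkord xpredT F) (@big_cat_nat _ _ _ s) //= 1?ltnW //.
rewrite [X in _ + X]big_ltn // [F s]/F ltnn /= subnn mulr1.
have -> : \sum_(0 <= k < s) F k = if I then x - 1 else 0.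
  rewrite big_mkord -(sum_below Ns); case: I @F => F.
    apply: eq_bigr => k _; rewrite /F implybT ltnNge (ltnW (ltn_ord k)) /=.
    by rewrite (eqP (ltnW (ltn_ord k) : k - s == 0)%N) mulr1.
  by rewrite big1 // => k _; rewrite /F ltn_ord.
have -> : \sum_(s.+1 <= k < m) F k = if E then y - 1 else 0.
  rewrite -(sum_above Nm sm); case: E @F => F.
    apply: eq_big_nat => k /andP[sk _]; rewrite /F implybT ltnNge (ltnW sk) /=.
    by rewrite (eqP (ltnW sk : s - k == 0)%N) mul1r.
  by rewrite big_nat big1 // => k /andP[sk _]; rewrite /F sk andbF.
by clear F; case: I; case: E => /=; ring.
Qed.

Variables (n : nat) (P : {fset 'rV[int]_n}) (r : 'I_n -> nat).

Lemma ranked_tutte_prod : ranked_tutte P r x y =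
  \sum_(a <- P) \prod_i
    if i \in ranked_int_active P r a
    then if i \in ranked_ext_active P r a then x + y - 1 else x
    else if i \in ranked_ext_active P r a then y else 1.
Proof.
rewrite /ranked_tutte; apply: eq_bigr => a _; rewrite -!prodr_const.
rewrite !(big_mkcond (fun i => i \in _)) -!big_split; apply: eq_bigr => i _.
by rewrite !(in_setD, in_setI); case: (_ \in _); case: (_ \in _) => /=; ring.
Qed.

Lemma absz_excess c (a : 'rV[int]_n) :
  `|excess c a|%N = (\sum_i `|(Num.max (a 0 i - c i) 0)%R|)%N.
Proof.
rewrite -[RHS]absz_nat (big_morph Posz PoszD (erefl _)); congr absz.
by apply: eq_bigr => i _; lia.
Qed.

Lemma absz_deficit c (a : 'rV[int]_n) :
  `|deficit c a|%N = (\sum_i `|(Num.max (c i - a 0 i) 0)%R|)%N.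
Proof.
rewrite -[RHS]absz_nat (big_morph Posz PoszD (erefl _)); congr absz.
by apply: eq_bigr => i _; lia.
Qed.

(** The points [c] range over the box of radius [M + N] around the origin, which
    contains a margin of [N] around each point of [P]; the digit [k i] encodes
    the coordinate [k i - (M + N)]. *)
Lemma ranked_tutte_lattice_sum (M : nat) :
    (forall (a : 'rV[int]_n) i, a \in P -> (`|a 0%R i| <= M)%N) ->
  ranked_tutte P r x y =
  \sum_(k : {ffun 'I_n -> 'I_((M + N).*2.+1)})
    \sum_(a <- P) let c i := (k i)%:Z - (M + N)%:Z in
      if compatible P r c a
      then u ^+ `|excess c a|%N * v ^+ `|deficit c a|%N else 0.
Proof.
move=> boundP; rewrite ranked_tutte_prod exchange_big /= !big_seq.
apply: eq_bigr => a aP.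
pose s (i : 'I_n) : nat := absz (a 0 i + (M + N)%:Z).
have sE i : a 0 i = (s i)%:Z - (M + N)%:Z.
  rewrite /s; move: (boundP a i aP); set z : int := a 0 i; lia.
have sM i : (N <= s i <= M.*2 + N)%N.
  rewrite /s -muln2; move: (boundP a i aP); set z : int := a 0 i; lia.
have Ns i : (N <= (s i).+1)%N by have := sM i; lia.
have Nm i : (s i + N <= (M + N).*2.+1)%N by have := sM i; rewrite -!muln2; lia.
have sm i : (s i < (M + N).*2.+1)%N by have := sM i; rewrite -!muln2; lia.
rewrite (eq_bigr _ (fun i _ => esym (sum_coordinate _ _ (Ns i) (Nm i) (sm i)))).
rewrite bigA_distr_bigA /=; apply: eq_bigr => k _.
pose c i := (k i)%:Z - (M + N)%:Z.
case: ifPn => [/forallP comp | /forallPn[i ncomp]].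
  rewrite absz_excess absz_deficit !expr_sum -big_split /=.
  apply: eq_bigr => i _; have := comp i; rewrite sE /= !ltrD2r !ltz_nat => ->.
  by congr (_ ^+ _ * _ ^+ _); lia.
rewrite (bigD1 i) //=; move: ncomp; rewrite sE !ltrD2r !ltz_nat => /negPf->.
by rewrite mul0r.
Qed.

End LatticePointSum.

(** On each side only one point of [P], the compatible one, contributes.  The
    two points may differ, but both minimise the excess and the deficit over
    [P], so their contributions agree. *)
Lemma sum_compatible_invariant (R : pzRingType) (u v : R) n
    (P : {fset 'rV[int]_n}) (r r' : 'I_n -> nat) (c : 'I_n -> int) :
  polymatroid P -> injective r -> injective r' ->
  let F s a := if compatible P s c a
               then u ^+ `|excess c a|%N * v ^+ `|deficit c a|%N else 0 in
  \sum_(a <- P) F r a = \sum_(a <- P) F r' a.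
Proof.
move=> polyP r_inj r'_inj F.
have single s a : injective s -> a \in P -> compatible P s c a ->
    \sum_(b <- P) F s b = u ^+ `|excess c a|%N * v ^+ `|deficit c a|%N.
  move=> s_inj aP ca; rewrite (bigD1_seq a) ?fset_uniq //= /F ca.
  rewrite big_seq_cond big1 ?addr0 // => b /andP[bP /eqP neq_ba].
  by case: ifP => // cb; case: neq_ba; apply: (compatible_unique s_inj polyP) cb ca.
have [a aP ca] := compatible_exists r polyP c.
have [b bP cb] := compatible_exists r' polyP c.
rewrite (single r a) // (single r' b) //.
have [ex_ab de_ab] := compatible_min_excess_deficit r_inj polyP aP bP ca.
have [ex_ba de_ba] := compatible_min_excess_deficit r'_inj polyP bP aP cb.
have -> : excess c a = excess c b by apply/le_anti/andP.
by have -> : deficit c a = deficit c b by apply/le_anti/andP.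
Qed.

Lemma ranked_tutte_nilpotent (R : comPzRingType) (N : nat) (x y u v : R) n
    (P : {fset 'rV[int]_n}) (r r' : 'I_n -> nat) :
  u ^+ N = 0 -> v ^+ N = 0 -> x * (1 - u) = 1 -> y * (1 - v) = 1 ->
  polymatroid P -> injective r -> injective r' ->
  ranked_tutte P r x y = ranked_tutte P r' x y.
Proof.
move=> uN vN xu yv polyP r_inj r'_inj.
pose M := (\sum_(a <- P) \sum_i `|(a : 'rV[int]_n) 0%R i|)%N.
have boundP (a : 'rV[int]_n) i : a \in P -> (`|a 0%R i| <= M)%N.
  move=> aP; rewrite /M (bigD1_seq a) ?fset_uniq //= (bigD1 i) //=.
  by rewrite -addnA leq_addr.
rewrite !(ranked_tutte_lattice_sum uN vN xu yv _ boundP).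
by apply: eq_bigr => k _; apply: sum_compatible_invariant.
Qed.

(** * Evaluation at odd integers *)

Lemma ranked_tutte_rmorph (R S : pzRingType) (f : {rmorphism R -> S}) x y n
    (P : {fset 'rV[int]_n}) (r : 'I_n -> nat) :
  f (ranked_tutte P r x y) = ranked_tutte P r (f x) (f y).
Proof.
rewrite /ranked_tutte rmorph_sum; apply: eq_bigr => a _ /=.
by rewrite !rmorphM !rmorphXn rmorphB rmorphD rmorph1.
Qed.

(** With [u = 1 - 1/p = (p - 1)/p], the numerator is even, so [u ^+ N] is
    divisible by [2 ^ N]. *)
Lemma odd_nilpotent_inverse (p N : nat) : (0 < N)%N -> odd p ->
  exists2 u : 'Z_(2 ^ N), u ^+ N = 0 & p%:R * (1 - u) = 1.
Proof.
move=> N_gt0 p_odd; have m_gt1 : (1 < 2 ^ N)%N by rewrite -{1}(expn0 2) ltn_exp2l.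
have p_unit : (p%:R : 'Z_(2 ^ N)) \is a GRing.unit.
  by rewrite unitZpE // coprimeXl // coprime2n.
exists (1 - p%:R^-1); last by rewrite opprB addrC subrK divrr.
have -> : 1 - p%:R^-1 = (2 * p./2)%:R / p%:R :> 'Z_(2 ^ N).
  rewrite -[p in LHS]odd_double_half p_odd -[p in _ / p%:R]odd_double_half p_odd.
  rewrite -[p]odd_double_half p_odd in p_unit.
  by rewrite -{1}(divrr p_unit) -mulN1r -mulrDl natrD addrAC subrr add0r mul2n.
by rewrite exprMn -natrX expnMn natrM pchar_Zp // !mul0r.
Qed.

Lemma int_eq0_Zp (d : int) N : (`|d| < 2 ^ N)%N -> (d%:~R : 'Z_(2 ^ N)) = 0 ->
  d = 0.
Proof.
case: N => [|N] lt_d d0; first by move: lt_d; rewrite expn0; lia.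
have m_gt1 : (1 < 2 ^ N.+1)%N by rewrite -{1}(expn0 2) ltn_exp2l.
have abs_d0 : (`|d|%N%:R : 'Z_(2 ^ N.+1)) = 0.
  rewrite pmulrn; have [->|->] : `|d|%N%:Z = d \/ `|d|%N%:Z = - d by lia.
    exact: d0.
  by rewrite mulrNz d0 oppr0.
by have := congr1 val abs_d0; rewrite /= val_Zp_nat // modn_small //; lia.
Qed.

Lemma ranked_tutte_odd n (P : {fset 'rV[int]_n}) (r r' : 'I_n -> nat) p q :
  polymatroid P -> injective r -> injective r' -> odd p -> odd q ->
  ranked_tutte P r (p%:Z : int) q%:Z = ranked_tutte P r' p%:Z q%:Z.
Proof.
move=> polyP r_inj r'_inj p_odd q_odd; apply/eqP; rewrite -subr_eq0; apply/eqP.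
set d := _ - _.
have [u uN pu] := odd_nilpotent_inverse (ltn0Sn `|d|) p_odd.
have [v vN qv] := odd_nilpotent_inverse (ltn0Sn `|d|) q_odd.
(* The modulus exceeds the difference [d], so that [d] is zero as soon as the
   modulus divides it. *)
apply: (@int_eq0_Zp d `|d|%N.+1); first by rewrite ltnW // ltn_expl.
rewrite {1}/d rmorphB /= !ranked_tutte_rmorph /=.
apply/eqP; rewrite subr_eq0; apply/eqP.
exact: ranked_tutte_nilpotent uN vN pu qv polyP r_inj r'_inj.
Qed.

Lemma poly_odd_roots (A : {poly int}) :
  (forall p : nat, odd p -> A.[p%:Z] = 0) -> A = 0.
Proof.
move=> A_odd; apply/eqP/negPn/negP => A_neq0.
pose rs : seq int := [seq (k.*2.+1)%:Z | k <- iota 0 (size A)].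
have := @max_poly_roots _ A rs A_neq0.
rewrite size_map size_iota ltnn => no_roots; apply: notF; apply: no_roots.
  by apply/allP => _ /mapP[k _ ->]; apply/eqP/A_odd; rewrite /= odd_double.
by rewrite map_inj_uniq ?iota_uniq // => k l []; lia.
Qed.

(** Two applications of the univariate case: first in the variable of index
    [0], for each odd value of the other one, then to each coefficient so
    obtained, as a polynomial in the variable of index [1]. *)
Lemma mpoly_odd_zeros (D : {mpoly int[2]}) :
    (forall p q : nat, odd p -> odd q ->
       D.@[fun i : 'I_2 => if i == 0 then p%:Z else q%:Z] = 0) ->
  D = 0.
Proof.
move=> D_odd; apply/mpolyP => m; rewrite mcoeff0.
pose A q : {poly int} :=
  \sum_(m' <- msupp D) (D@_m' * q%:Z ^+ m' 1) *: 'X^(m' 0).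
have A0 q : odd q -> A q = 0.
  move=> q_odd; apply: poly_odd_roots => p p_odd.
  rewrite -(D_odd p q p_odd q_odd) mevalE /A horner_sum.
  apply: eq_bigr => m' _; rewrite hornerZ hornerXn -mulrA; congr (_ * _).
  rewrite big_ord_recl big_ord1 mulrC /=.
  by congr (_ ^+ m' _ * _ ^+ m' _); apply: val_inj.
pose B : {poly int} :=
  \sum_(m' <- msupp D) (D@_m' * (m' 0 == m 0)%:R) *: 'X^(m' 1).
have B0 : B = 0.
  apply: poly_odd_roots => q /A0/(congr1 (fun A : {poly int} => A`_(m 0))).
  rewrite coef0 /A coef_sum => <-; rewrite /B horner_sum.
  apply: eq_bigr => m' _; rewrite hornerZ hornerXn coefZ coefXn eq_sym.
  by rewrite mulrAC.
have := congr1 (fun B : {poly int} => B`_(m 1)) B0; rewrite coef0 /B coef_sum.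
have E m' : m' != m -> ((D@_m' * (m' 0 == m 0)%:R) *: 'X^(m' 1))`_(m 1) = 0.
  move=> neq; rewrite coefZ coefXn.
  have [e0|] := eqVneq (m' 0) (m 0); last by rewrite mulr0 mul0r.
  have [e1|] := eqVneq (m 1) (m' 1); last by rewrite mulr0.
  case/eqP: neq; apply/mnmP => i.
  have [->|i1] := eqVneq i 0; first exact: e0.
  suff -> : i = 1 by [].
  by apply: val_inj; move: (ltn_ord i) i1; rewrite -val_eqE /=; lia.
have [m_in|m_out] := boolP (m \in msupp D); last by rewrite memN_msupp_eq0.
rewrite (bigD1_seq m) ?msupp_uniq //= big1 => [|m' /E //].
by rewrite coefZ coefXn !eqxx !mulr1 addr0.
Qed.

(** * Permuting coordinates *)

Section PermutedPolymatroid.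

Variables (n : nat) (P : {fset 'rV[int]_n}) (w : 'S_n).

(** Coordinate [i] of [a] becomes coordinate [w^-1 i] of [col_perm w a]. *)
Definition perm_rank (i : 'I_n) : nat := (w^-1)%g i.

Lemma col_perm_inj : injective (@col_perm int 1 n w).
Proof.
move=> a b /matrixP ab; apply/rowP => i.
by have := ab 0 ((w^-1)%g i); rewrite !mxE permKV.
Qed.

Lemma col_perm_move (a : 'rV[int]_n) i j :
  col_perm w a - basis_vec i + basis_vec j =
  col_perm w (a - basis_vec (w i) + basis_vec (w j)).
Proof. by apply/rowP => k; rewrite !mxE !(inj_eq perm_inj). Qed.

Lemma mem_perm_image a : (col_perm w a \in perm_image w P) = (a \in P).
Proof. by rewrite mem_imfset //=; apply: col_perm_inj. Qed.

Lemma exists_perm (Q : pred 'I_n) : [exists i, Q (w i)] = [exists i, Q i].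
Proof.
apply/existsP/existsP => [[i Qi]|[i Qi]]; first by exists (w i).
by exists ((w^-1)%g i); rewrite permKV.
Qed.

Lemma int_active_perm_image a : int_active (perm_image w P) (col_perm w a) =
  w @^-1: ranked_int_active P perm_rank a.
Proof.
apply/setP => i; rewrite !inE -[in RHS]exists_perm; congr (~~ _).
by apply: eq_existsb => j; rewrite /perm_rank !permK col_perm_move mem_perm_image.
Qed.

Lemma ext_active_perm_image a : ext_active (perm_image w P) (col_perm w a) =
  w @^-1: ranked_ext_active P perm_rank a.
Proof.
apply/setP => i; rewrite !inE -[in RHS]exists_perm; congr (~~ _).
apply: eq_existsb => j; rewrite /perm_rank !permK.
by rewrite addrAC col_perm_move mem_perm_image addrAC.
Qed.

Lemma tutte_perm_image :
  tutte (perm_image w P) = ranked_tutte P perm_rank varx vary.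
Proof.
rewrite /tutte big_imfset /=; last by move=> a b _ _; apply: col_perm_inj.
apply: eq_bigr => a _; rewrite int_active_perm_image ext_active_perm_image.
by rewrite -!preimsetD -preimsetI !card_preimset //; apply: perm_inj.
Qed.

End PermutedPolymatroid.

Theorem theorem4p7 (n : nat) (P : {fset 'rV[int]_n}) (w : 'S_n) :
  (0 < n)%N -> polymatroid P -> tutte P = tutte (perm_image w P).
Proof.
move=> _ polyP; rewrite tutte_perm_image.
have -> : tutte P = ranked_tutte P (@nat_of_ord n) varx vary by [].
apply/eqP; rewrite -subr_eq0; apply/eqP/mpoly_odd_zeros => p q p_odd q_odd.
rewrite rmorphB /= !ranked_tutte_rmorph /= /varx /vary !mevalXU /=.
apply/eqP; rewrite subr_eq0; apply/eqP/ranked_tutte_odd => //.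
  exact: ord_inj.
by move=> i j /ord_inj/perm_inj.
Qed.
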